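(* Let $d$ be an integer with $1\le d\leq 17$ and let $\Gamma\subset \mathcal I_d$. Then for any real numbers $\{z_{\boldsymbol i}\}_{\boldsymbol i\in\Gamma}$, there is a unique polynomial of the form $$p=\sum_{\boldsymbol i \in \Gamma}c_{\boldsymbol i} B^d_{\boldsymbol i},\qquad c_{\boldsymbol i}\in\mathbb R,$$ that solves the constrained interpolation problem $$p(\xi_{\boldsymbol i})=z_{\boldsymbol i},\qquad \boldsymbol i\in\Gamma.$$
   Context: For a positive integer $d$, let $\mathcal I_d$ be the set of all triples $\boldsymbol i=(i,j,k)$ of non-negative integers with $i+j+k=d$. For a triangle $T$ in the plane, points are written in barycentric coordinates $\boldsymbol v=(u,v,w)$, $u+v+w=1$, with respect to $T$. The Bernstein basis polynomials of total degree $d$ are $B^d_{\boldsymbol i}(\boldsymbol v):=\frac{d!}{i!\,j!\,k!}u^iv^jw^k$ for $\boldsymbol i=(i,j,k)\in\mathcal I_d$, with the convention $0^0=1$. The domain points are $\xi_{\boldsymbol i}:=\boldsymbol i/d=(i/d,j/d,k/d)$ (barycentric coordinates), $\boldsymbol i\in\mathcal I_d$. The inclusion $\Gamma\subset\mathcal I_d$ is not necessarily strict. *)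

(* Defs.v *)
From mathcomp Require Import all_boot all_order all_algebra.
From mathcomp Require Import reals.

Set Implicit Arguments.
Unset Strict Implicit.
Unset Printing Implicit Defensive.

Import GRing.Theory.

Local Open Scope ring_scope.

(* The bound by d on each component loses nothing, since i + j + k = d. *)
Definition tri_index (d : nat) : finType :=
  {t : 'I_d.+1 * 'I_d.+1 * 'I_d.+1 | (t.1.1 + t.1.2 + t.2 == d)%N}.

Definition idx_i (d : nat) (t : tri_index d) : nat := (val t).1.1.
Definition idx_j (d : nat) (t : tri_index d) : nat := (val t).1.2.
Definition idx_k (d : nat) (t : tri_index d) : nat := (val t).2.

(* A triangle is given by the 3 x 2 matrix T whose rows are its vertices in the
   Cartesian plane 'rV[R]_2; the extra column of ones makes affine combinations
   of the vertices linear ones. *)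
Definition homog (R : realType) (n : nat) (A : 'M[R]_(n, 2)) : 'M[R]_(n, 3) :=
  row_mx A (const_mx 1 : 'M[R]_(n, 1)).

Definition triangle (R : realType) (T : 'M[R]_(3, 2)) : Prop :=
  homog T \in unitmx.

(* The row (u, v, w), see baryP. *)
Definition bary (R : realType) (T : 'M[R]_(3, 2)) (x : 'rV[R]_2) : 'rV[R]_3 :=
  homog x *m invmx (homog T).

Definition point_of_bary (R : realType) (T : 'M[R]_(3, 2)) (v : 'rV[R]_3) :
  'rV[R]_2 := v *m T.

Definition bernstein (R : realType) (d : nat) (t : tri_index d)
    (v : 'rV[R]_3) : R :=
  (d`!)%:R / ((idx_i t)`! * (idx_j t)`! * (idx_k t)`!)%:R
  * (v 0 0 ^+ idx_i t * v 0 1 ^+ idx_j t * v 0 2%:R ^+ idx_k t).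

Definition domain_bary (R : realType) (d : nat) (t : tri_index d) : 'rV[R]_3 :=
  \row_(l < 3) ((nth 0%N [:: idx_i t; idx_j t; idx_k t] l)%:R / d%:R).

Definition domain_point (R : realType) (T : 'M[R]_(3, 2)) (d : nat)
    (t : tri_index d) : 'rV[R]_2 :=
  point_of_bary T (domain_bary R t).

(* Polynomials are identified with polynomial functions on the plane. *)
Definition bernstein_form (R : realType) (T : 'M[R]_(3, 2)) (d : nat)
    (Gamma : {set tri_index d}) (p : 'rV[R]_2 -> R) : Prop :=
  exists c : tri_index d -> R,
    forall x, p x = \sum_(t in Gamma) c t * bernstein t (bary T x).

Lemma baryP (R : realType) (T : 'M[R]_(3, 2)) (x : 'rV[R]_2) (v : 'rV[R]_3) :
  triangle T ->
  v = bary T x <-> \sum_(l < 3) v 0 l = 1 /\ point_of_bary T v = x.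
Proof.
move=> hT; have hom : v *m homog T =
    row_mx (v *m T) (const_mx (\sum_(l < 3) v 0 l) : 'M_(1, 1)).
  apply: etrans (mul_mx_row v T (const_mx 1)) _; congr row_mx.
  apply/matrixP=> a b; rewrite !mxE; apply: eq_bigr => l _.
  by rewrite mxE mulr1 (ord1 a).
split=> [vE|[v1 <-]]; last first.
  suff homE : homog (point_of_bary T v) = v *m homog T.
    by rewrite /bary homE mulmxK.
  by rewrite hom v1.
have : v *m homog T = homog x by rewrite vE /bary mulmxKV.
rewrite hom => e; have [pE cE] := @eq_row_mx _ 1 2 1 _ _ _ _ e.
by split; [move/matrixP/(_ 0 0): cE; rewrite !mxE | exact: pE].
Qed.

Lemma bary_domain_point (R : realType) (T : 'M[R]_(3, 2)) (d : nat)
    (t : tri_index d) :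
  triangle T -> (0 < d)%N -> bary T (domain_point T t) = domain_bary R t.
Proof.
move=> hT d0; apply/esym/(baryP _ _ hT); split=> //.
rewrite !big_ord_recl big_ord0 !mxE /= addr0 -!mulrDl -!natrD addnA.
rewrite /idx_i /idx_j /idx_k (eqP (valP t)) divff //.
by rewrite Num.Theory.pnatr_eq0 -lt0n.
Qed.

(* Main.v *)
Require Import Defs.
From Stdlib Require Import ZArith.
From mathcomp Require Import all_boot all_order all_algebra.
From mathcomp Require Import reals boolp.
From mathcomp Require Import ssrZ zify ring lra.

Set Implicit Arguments.
Unset Strict Implicit.
Unset Printing Implicit Defensive.

Import Order.TTheory GRing.Theory Num.Theory.

Local Open Scope ring_scope.

(** Up to the factor d^d, the collocation matrix of the Bernstein basis at the
    domain points is the matrix of natural numbers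
      K(s, t) = d! / (t_1! t_2! t_3!) * s_1^t_1 s_2^t_2 s_3^t_3,
    and the theorem says that every principal submatrix of K is invertible.
    A matrix whose quadratic form is positive definite has this property, since
    its restriction to any set of indices is again positive definite. The form
    of K on the whole triangle is however indefinite for d = 17, so K is first
    cut along the strata vertices, edges, interior, that is, by the number of
    nonzero components of an index. As K(s, t) = 0 unless the support of t lies
    in that of s, the matrix K is block triangular for this stratification, and
    it suffices that the diagonal blocks be positive definite
    ([stratum_posdef]): if c is in the kernel of the submatrix and c_t <> 0 with
    t in the lowest possible stratum, the rows of that stratum only see the
    entries of c in it, which must then vanish ([bernstein_unisolvent]).

    Positive definiteness of the diagonal blocks for d <= 17 is a finite
    computation. Exchanging the first two barycentric coordinates preserves the
    form, which splits it into its even and odd parts ([qform_fold]) and divides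
    the work by four. For each part an integer matrix L, close to a Cholesky
    factor of a multiple S of the symmetrised part, is given; S - L L^T is then
    so strongly dominated by its diagonal that it is positive definite
    ([dominated_qform_ge]), and L L^T is a Gram matrix, hence positive
    semidefinite ([gram_ge0]). The inequalities on the integer matrix S - L L^T
    are verified by evaluation ([certificates_ok]). *)

(** * Quadratic forms dominated by their diagonal *)

Section QuadraticForms.
Variable R : realFieldType.

Definition qform (A : Type) (rs : seq A) (f : A -> R) (E : A -> A -> R) : R :=
  \sum_(a <- rs) \sum_(b <- rs) f a * f b * E a b.

(** An off-diagonal term is bounded by
    2 f_a f_b E_ab >= - rho (f_a^2 + f_b^2), so that every square is charged rho
    once for each other index. The parameter c, fixed while the list shrinks, is
    what makes the induction on the list go through. *)
Lemma dominated_qform_ge (A : eqType) (E : A -> A -> R) (rho : R) (f : A -> R)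
    (c : R) (rs : seq A) :
    {in rs &, forall a b, E a b = E b a} ->
    all (fun a => c * rho <= E a a) rs ->
    pairwise (fun a b => `|E a b| <= rho) rs ->
  (c + 1 - (size rs)%:R) * rho * (\sum_(a <- rs) f a ^+ 2) <= qform rs f E.
Proof.
rewrite /qform; elim: rs => [|a rs IH] EC /=.
  by move=> _ _; rewrite !big_nil mulr0.
move=> /andP[da drs] /andP[oa ors].
have ECrs : {in rs &, forall a b, E a b = E b a}.
  by move=> b b' brs b'rs; apply: EC; rewrite inE ?brs ?b'rs orbT.
have {IH drs ors ECrs} IH := IH ECrs drs ors.
rewrite !big_cons.
under [X in _ <= _ + X]eq_bigr => b _ do rewrite big_cons.
rewrite big_split /=.
have -> : \sum_(b <- rs) f b * f a * E b a = \sum_(b <- rs) f a * f b * E a b.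
  by apply: eq_big_seq => b brs; rewrite EC ?mem_head ?inE ?brs ?orbT //
    (mulrC (f b)).
have cross : - (rho * ((size rs)%:R * f a ^+ 2 + \sum_(b <- rs) f b ^+ 2))
    <= \sum_(b <- rs) f a * f b * E a b *+ 2.
  elim: rs oa {IH EC} => [|b rs IHrs] /=.
    by move=> _; rewrite !big_nil mul0r addr0 mulr0 oppr0.
  move=> /andP[ob orest]; rewrite !big_cons; move: (IHrs orest).
  have : - (rho * (f a ^+ 2 + f b ^+ 2)) <= f a * f b * E a b *+ 2.
    move: ob; rewrite ler_norml => /andP[lo hi]; rewrite -mulr_natr.
    have h1 := mulr_ge0 (_ : 0 <= rho - E a b) (sqr_ge0 (f a - f b)).
    have h2 := mulr_ge0 (_ : 0 <= rho + E a b) (sqr_ge0 (f a + f b)).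
    have := h1 ltac:(lra); have := h2 ltac:(lra); lra.
  by rewrite -natr1; lra.
rewrite sumrMnl in cross; rewrite -natr1.
have := ler_wpM2r (sqr_ge0 (f a)) da.
by move: cross IH; rewrite -mulr_natr; lra.
Qed.

Lemma qformD (A : Type) (rs : seq A) f E E' :
  qform rs f (fun a b => E a b + E' a b) = qform rs f E + qform rs f E'.
Proof.
rewrite /qform -big_split; apply: eq_bigr => a _ /=.
by rewrite -big_split; apply: eq_bigr => b _ /=; rewrite mulrDr.
Qed.

End QuadraticForms.

(** * Integer certificates of positivity *)

(* The key Z of this scope is taken by the scope of int. *)
Delimit Scope Z_scope with BZ.

Fixpoint dotZ (l m : seq Z) : Z :=
  match l, m with
  | x :: l', y :: m' => (x * y + dotZ l' m')%BZ
  | _, _ => 0%BZ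
  end.

Lemma dotZC l m : dotZ l m = dotZ m l.
Proof. by elim: l m => [|x l IH] [|y m] //=; rewrite IH Z.mul_comm. Qed.

Section IntegerForms.
Variable R : realFieldType.

Definition ofZ (z : Z) : R := (int_of_Z z)%:~R.

Lemma ofZD x y : ofZ (x + y)%BZ = ofZ x + ofZ y.
Proof. by rewrite /ofZ -intrD -rmorphD. Qed.
Lemma ofZB x y : ofZ (x - y)%BZ = ofZ x - ofZ y.
Proof. by rewrite /ofZ -intrB -rmorphB. Qed.
Lemma ofZM x y : ofZ (x * y)%BZ = ofZ x * ofZ y.
Proof. by rewrite /ofZ -intrM -rmorphM. Qed.
Lemma ofZ_nat n : ofZ (Z.of_nat n) = n%:R.
Proof. by rewrite /ofZ -[n in RHS]/(absz n) natr_absz; congr (_%:~R); lia. Qed.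
Lemma ofZ0 : ofZ 0%BZ = 0. Proof. by []. Qed.
Lemma ler_ofZ x y : (ofZ x <= ofZ y) = (x <=? y)%BZ.
Proof. by rewrite /ofZ ler_int; lia. Qed.
Lemma ltr_ofZ x y : (ofZ x < ofZ y) = (x <? y)%BZ.
Proof. by rewrite /ofZ ltr_int; lia. Qed.
Lemma eqr_ofZ x y : (ofZ x == ofZ y) = (x == y).
Proof. by rewrite /ofZ eqr_int (can_eq int_of_ZK). Qed.
Lemma norm_ofZ x : `|ofZ x| = ofZ (Z.abs x).
Proof. by rewrite /ofZ -intr_norm; congr (_%:~R); lia. Qed.

Lemma dotZE l m : dotZ l m =
  (head 0%BZ l * head 0%BZ m + dotZ (behead l) (behead m))%BZ.
Proof. by case: l m => [|x [|y l]] [|z [|t m]] //=; lia. Qed.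

(** The form is the sum of the squares of the linear forms given by the
    columns of the matrix with rows l a; columns are peeled off one by one. *)
Lemma gram_ge0 (A : eqType) (rs : seq A) (f : A -> R) (l : A -> seq Z) :
  0 <= qform rs f (fun a b => ofZ (dotZ (l a) (l b))).
Proof.
rewrite /qform; have [N] : exists N, {in rs, forall a, size (l a) <= N}%N.
  exists (\max_(a <- rs) size (l a))%N => a ars.
  exact: (leq_bigmax_seq (F := fun a => size (l a))) ars isT.
elim: N l => [|N IH] l szl.
  rewrite big_seq big1 // => a ars; rewrite big1_seq // => b _.
  by move: (szl a ars); case: (l a) => //= _; rewrite ofZ0 mulr0.
pose h a := ofZ (head 0%BZ (l a)).
rewrite (_ : \sum_(a <- rs) _ = (\sum_(a <- rs) f a * h a) ^+ 2 +
  \sum_(a <- rs) \sum_(b <- rs)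
     f a * f b * ofZ (dotZ (behead (l a)) (behead (l b)))).
  apply: addr_ge0; first exact: sqr_ge0.
  by apply: IH => a ars; rewrite size_behead; move: (szl a ars); case: size.
rewrite expr2 mulr_suml -big_split; apply: eq_bigr => a _ /=.
rewrite mulr_sumr -big_split; apply: eq_bigr => b _ /=.
by rewrite dotZE ofZD ofZM /h; ring.
Qed.

End IntegerForms.

Definition point : Type := (nat * nat * nat)%type.

(** The pairs (s, l) list the indices s of a symmetric matrix S, each with its
    row l of a lower triangular matrix L, cut at the diagonal; these are the
    entries of S - L L^T. *)
Definition residual (S : point -> point -> Z) (a b : point * seq Z) : Z :=
  (S a.1 b.1 - dotZ a.2 b.2)%BZ.

(** [pairwise] visits each unordered pair once, which halves the number of
    scalar products. *)
Definition check_rows S (rho : Z) (rows : seq (point * seq Z)) : bool :=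
  all (fun a => Z.of_nat (size rows) * rho <=? residual S a a)%BZ rows
  && pairwise (fun a b => Z.abs (residual S a b) <=? rho)%BZ rows.

Lemma check_rows_qform_ge (R : realFieldType) S rho rows (f : point -> R) :
    {in unzip1 rows &, forall s t, S s t = S t s} -> check_rows S rho rows ->
  ofZ R rho * (\sum_(s <- unzip1 rows) f s ^+ 2)
    <= qform (unzip1 rows) f (fun s t => ofZ R (S s t)).
Proof.
move=> SC /andP[dia off].
rewrite /qform !big_map; under [leRHS]eq_bigr do rewrite big_map.
pose g (a : point * seq Z) := f a.1.
pose E (a b : point * seq Z) : R := ofZ R (residual S a b).
have EC : {in rows &, forall a b, E a b = E b a}.
  by move=> a b ars brs; rewrite /E /residual SC ?map_f // dotZC.
have := @dominated_qform_ge R _ E (ofZ R rho) g (size rows)%:R rows EC.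
rewrite addrAC subrr add0r mul1r.
have -> : all (fun a => (size rows)%:R * ofZ R rho <= E a a) rows.
  by apply: sub_all dia => a; rewrite -(ler_ofZ R) ofZM ofZ_nat.
have -> : pairwise (fun a b => `|E a b| <= ofZ R rho) rows.
  by apply: sub_pairwise off => a b; rewrite -(ler_ofZ R) -norm_ofZ.
move=> /(_ isT isT) /le_trans; apply.
rewrite -[leLHS]addr0 -/(qform rows g (fun a b => ofZ R (S a.1 b.1))).
have -> : qform rows g (fun a b => ofZ R (S a.1 b.1)) =
  qform rows g E + qform rows g (fun a b => ofZ R (dotZ a.2 b.2)).
  rewrite -qformD /qform; apply: eq_bigr => a _; apply: eq_bigr => b _.
  by rewrite /E /residual ofZB subrK.
by rewrite lerD2l gram_ge0.
Qed.

(** * Indices, strata and the exchange of two coordinates *)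

Definition swap (p : point) : point := (p.1.2, p.1.1, p.2).
Definition points (d : nat) : seq point :=
  [seq (i, j, d - i - j)%N | i <- iota 0 d.+1, j <- iota 0 (d - i).+1].
Definition support_size (p : point) : nat :=
  ((p.1.1 != 0) + (p.1.2 != 0) + (p.2 != 0))%N.

Definition stratum d m := [seq p <- points d | support_size p == m].

(** One representative of each orbit of [swap]; antisymmetric functions vanish at
    the fixed points, which are left out for them. *)
Definition half_stratum (anti : bool) d m :=
  [seq p <- stratum d m | p.1.1 + anti <= p.1.2]%N.

Lemma mem_points d p : (p \in points d) = (p.1.1 + p.1.2 + p.2 == d)%N.
Proof.
apply/allpairsPdep/eqP => [[i [j [+ + ->]]]|]; rewrite ?mem_iota /=; first lia.
case: p => [[i j] k] <-; exists i, j; rewrite !in_cons !mem_iota /=; split; try lia.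
by congr (_, _); lia.
Qed.

Lemma points_uniq d : uniq (points d).
Proof.
apply: allpairs_uniq_dep => [|i _|]; rewrite ?iota_uniq //.
by move=> [i j] [i' j'] _ _ /= [-> ->].
Qed.

Lemma swapK : involutive swap. Proof. by case=> [[i j] k]. Qed.

Lemma stratum_swap d m : perm_eq [seq swap p | p <- stratum d m] (stratum d m).
Proof.
have u : uniq (stratum d m) by rewrite filter_uniq // points_uniq.
apply: uniq_perm => //; first by rewrite map_inj_uniq //; exact: inv_inj swapK.
move=> p; rewrite -[p in LHS]swapK (mem_map (inv_inj swapK)) !mem_filter.
by rewrite !mem_points /support_size /= addnC addnAC addnA; lia.
Qed.

Lemma mem_points_swap d p : (swap p \in points d) = (p \in points d).
Proof. by rewrite !mem_points /= (addnC p.1.2). Qed.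

Lemma half_stratum_points anti d m p :
  p \in half_stratum anti d m -> p \in points d.
Proof. by rewrite !mem_filter => /and3P[]. Qed.

(** * Splitting an invariant form into its even and odd parts *)

Section Folding.
Variable R : realFieldType.

(** A fixed point of [swap] is its own partner and would be counted twice. *)
Definition fold_weight (p : point) : R := if p.1.1 == p.1.2 then 2^-1 else 1.

Lemma sum_fold (P : seq point) (F : point -> R) :
    perm_eq [seq swap p | p <- P] P ->
  \sum_(p <- P) F p =
  \sum_(p <- [seq p <- P | p.1.1 <= p.1.2]%N) fold_weight p * (F p + F (swap p)).
Proof.
move=> permP; rewrite big_filter [RHS](bigID (fun p => p.1.1 == p.1.2)) /=.
rewrite [LHS](bigID (fun p => p.1.1 <= p.1.2)%N) /=.
rewrite [X in X + _](bigID (fun p => p.1.1 == p.1.2)) /= -addrA; congr (_ + _).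
  apply: eq_bigr => [[[i j] k]] /= /andP[_ /eqP e].
  by rewrite /fold_weight /swap /= -e eqxx; field.
rewrite -[X in _ + X](perm_big _ permP) big_map /=.
rewrite [X in _ + X](eq_bigl (fun p => (p.1.1 <= p.1.2)%N && (p.1.1 != p.1.2)));
  last by move=> p /=; lia.
rewrite -big_split; apply: eq_bigr => p /andP[_ /negPf ne].
by rewrite /fold_weight ne mul1r.
Qed.

(** With a = x + x o swap and b = x - x o swap, both sides expand to the same
    sum over pairs of orbits, because
    a_s a_t + b_s b_t = 2 (x_s x_t + x_(swap s) x_(swap t)) and
    a_s a_t - b_s b_t = 2 (x_s x_(swap t) + x_(swap s) x_t). *)
Lemma qform_fold (P : seq point) (x : point -> R) (H : point -> point -> R) :
    perm_eq [seq swap p | p <- P] P ->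
    (forall s t, H (swap s) (swap t) = H s t) ->
  2 * qform P x H =
    qform [seq p <- P | p.1.1 <= p.1.2]%N
      (fun s => fold_weight s * (x s + x (swap s)))
      (fun s t => H s t + H s (swap t))
  + qform [seq p <- P | p.1.1 < p.1.2]%N (fun s => x s - x (swap s))
      (fun s t => H s t - H s (swap t)).
Proof.
move=> permP Hswap.
have strict (F : point -> R) : (forall p, p.1.1 = p.1.2 -> F p = 0) ->
    \sum_(p <- [seq p <- P | p.1.1 < p.1.2]%N) F p =
    \sum_(p <- [seq p <- P | p.1.1 <= p.1.2]%N) fold_weight p * F p.
  move=> F0; rewrite !big_filter [RHS](bigID (fun p => p.1.1 == p.1.2)) /=.
  rewrite [X in _ = X + _]big1 ?add0r; last first.
    by move=> p /andP[_ /eqP /F0 ->]; rewrite mulr0.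
  apply: eq_big => [p|p lt_p]; first lia.
  by rewrite /fold_weight ltn_eqF ?mul1r.
have diag p : p.1.1 = p.1.2 -> x p - x (swap p) = 0.
  by case: p => [[i j] k] /= ->; rewrite subrr.
rewrite /qform strict; last first.
  by move=> p /diag e; rewrite big1 // => *; rewrite e !mul0r.
under [X in _ = _ + X]eq_bigr => s _.
  rewrite strict; last by move=> p /diag e; rewrite e mulr0 mul0r.
  over.
rewrite (sum_fold _ permP) mulr_sumr -big_split; apply: eq_bigr => s _ /=.
rewrite !(sum_fold _ permP) -big_split !mulr_sumr -big_split.
apply: eq_bigr => t _ /=.
rewrite Hswap -(Hswap (swap s) t) swapK; ring.
Qed.

End Folding.

(** * The collocation kernel *)

Section Kernel.
Variable R : realFieldType.

(** The value of the Bernstein polynomial of index t at s, with s read as a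
    triple of unscaled barycentric coordinates. *)
Definition kernel (s t : point) : R :=
  ((t.1.1 + t.1.2 + t.2)`!)%:R / (t.1.1`! * t.1.2`! * t.2`!)%:R
  * (s.1.1%:R ^+ t.1.1 * s.1.2%:R ^+ t.1.2 * s.2%:R ^+ t.2).

Lemma kernel_swap s t : kernel (swap s) (swap t) = kernel s t.
Proof.
case: s t => [[a b] c] [[i j] k]; rewrite /kernel /=.
by rewrite (addnC j) (mulnC j`!) (mulrC (b%:R ^+ j)).
Qed.

(** A vanishing coordinate of s kills every monomial in which it occurs: K is
    block triangular for the stratification by support size. *)
Lemma kernel_support (s t : point) :
  kernel s t != 0 -> (support_size t <= support_size s)%N.
Proof.
case: s t => [[a b] c] [[i j] k].
rewrite /kernel mulf_eq0 => /norP[_]; rewrite !mulf_eq0 !negb_or !expf_eq0 /=.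
rewrite !pnatr_eq0 /support_size /=; lia.
Qed.

Definition sym_kernel (s t : point) : R := kernel s t + kernel t s.

Definition fold_kernel (anti : bool) (s t : point) : R :=
  if anti then sym_kernel s t - sym_kernel s (swap t)
  else sym_kernel s t + sym_kernel s (swap t).

Lemma fold_kernelC anti s t : fold_kernel anti s t = fold_kernel anti t s.
Proof.
have symC s' t' : sym_kernel s' t' = sym_kernel t' s' by exact: addrC.
have sym_swap : sym_kernel s (swap t) = sym_kernel t (swap s).
  rewrite symC /sym_kernel -(kernel_swap t (swap s)).
  by rewrite -(kernel_swap (swap s) t) swapK.
by rewrite /fold_kernel symC sym_swap.
Qed.

End Kernel.

(** * The kernel in integer arithmetic *)

(** Powers and binomial coefficients are tabulated in normal form, so that the
    evaluation of an entry of the kernel costs only four products. *)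
Definition power_table : seq (seq Z) := Eval vm_compute in
  [seq [seq iter j (Z.mul (Z.of_nat i)) 1%BZ | j <- iota 0 18] | i <- iota 0 18].

Definition binomial_table : seq (seq Z) := Eval vm_compute in
  [seq [seq Z.of_nat 'C(n, k) | k <- iota 0 18] | n <- iota 0 18].

Definition lookup (tab : seq (seq Z)) i j : Z := nth 0%BZ (nth [::] tab i) j.

Definition kernelZ (s t : point) : Z :=
  (lookup binomial_table (t.1.1 + t.1.2 + t.2) t.1.1
   * lookup binomial_table (t.1.2 + t.2) t.1.2
   * (lookup power_table s.1.1 t.1.1
      * (lookup power_table s.1.2 t.1.2 * lookup power_table s.2 t.2)))%BZ.

Definition sym_kernelZ (s t : point) : Z := (kernelZ s t + kernelZ t s)%BZ.

Definition fold_kernelZ (anti : bool) (s t : point) : Z :=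
  if anti then (sym_kernelZ s t - sym_kernelZ s (swap t))%BZ
  else (sym_kernelZ s t + sym_kernelZ s (swap t))%BZ.

Lemma power_tableE i j : (i < 18)%N -> (j < 18)%N ->
  lookup power_table i j = Z.of_nat (i ^ j).
Proof.
move=> hi hj; have -> : power_table =
  [seq [seq iter j (Z.mul (Z.of_nat i)) 1%BZ | j <- iota 0 18] | i <- iota 0 18].
  by vm_compute.
rewrite /lookup (nth_map 0%N) ?size_iota // (nth_map 0%N) ?size_iota //.
rewrite !nth_iota // !add0n; elim: j {hj} => //= j ->; rewrite expnS; lia.
Qed.

Lemma binomial_tableE n k : (n < 18)%N -> (k < 18)%N ->
  lookup binomial_table n k = Z.of_nat 'C(n, k).
Proof.
move=> hn hk; have -> : binomial_table =
  [seq [seq Z.of_nat 'C(n, k) | k <- iota 0 18] | n <- iota 0 18].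
  by vm_compute.
rewrite /lookup (nth_map 0%N) ?size_iota // (nth_map 0%N) ?size_iota //.
by rewrite !nth_iota // !add0n.
Qed.

Lemma kernelZE (R : realFieldType) d s t : (d <= 17)%N ->
  s \in points d -> t \in points d -> ofZ R (kernelZ s t) = kernel R s t.
Proof.
case: s t => [[a b] c] [[i j] k] hd; rewrite !mem_points /= => hs ht.
rewrite /kernelZ /kernel /= !binomial_tableE ?power_tableE; try lia.
rewrite !ofZM !ofZ_nat !natrX !mulrA; do 3 congr (_ * _).
apply: (@mulIf _ (i`! * j`! * k`!)%:R).
  by rewrite pnatr_eq0 -lt0n !muln_gt0 !fact_gt0.
rewrite mulfVK; last by rewrite pnatr_eq0 -lt0n !muln_gt0 !fact_gt0.
rewrite -!natrM; congr (_%:R).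
have := @bin_fact (i + j + k) i ltac:(lia).
have := @bin_fact (j + k) j ltac:(lia).
rewrite -!addnA !addKn => <- <-; ring.
Qed.

(** The power of 2 compensates for the smaller entries of low degrees, so that
    rounding L to integers keeps enough relative precision. *)
Definition scaled d anti s t := (2 ^ Z.of_nat (17 - d) * fold_kernelZ anti s t)%BZ.

Lemma scaledE (R : realFieldType) d anti s t : (d <= 17)%N ->
    s \in points d -> t \in points d ->
  ofZ R (scaled d anti s t) =
  ofZ R (2 ^ Z.of_nat (17 - d))%BZ * fold_kernel R anti s t.
Proof.
move=> hd hs ht; have ht' : swap t \in points d by rewrite mem_points_swap.
rewrite /scaled ofZM /fold_kernelZ /sym_kernelZ /fold_kernel /sym_kernel.
by case: anti; rewrite ?ofZB !ofZD !(@kernelZE _ d).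
Qed.

(** * Certificates for the degrees up to 17 *)

(** A bound for the off-diagonal residuals, and the rows of L. *)
Definition certificate : Type := (Z * seq (seq Z))%type.

Definition check d m anti (c : certificate) : bool :=
  let pts := half_stratum anti d m in
  [&& (0 <? c.1)%BZ, size c.2 == size pts &
      check_rows (scaled d anti) c.1 (zip pts c.2)].

(** The row of L of a new index: prev lists the earlier indices with their rows,
    row is the part already computed. *)
Fixpoint cholesky_row (S : point -> Z) (diag : Z) (prev : seq (point * seq Z))
  (row : seq Z) : seq Z :=
  match prev with
  | [::] => rcons row (Z.sqrt (diag - dotZ row row))
  | (t, l) :: prev' =>
      cholesky_row S diag prev'
        (rcons row ((S t - dotZ row l) / last 1%BZ l)%BZ)
  end.

Definition cholesky S (shift : Z) (pts : seq point) : seq (point * seq Z) :=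
  foldl (fun rows s => rcons rows (s, cholesky_row (S s) (S s s - shift) rows [::]))
        [::] pts.

(** The rows of L have Euclidean norm at most 2 rho, because K is bounded by d^d,
    and the rounding errors of the entries behave like independent variables, so
    that rho is a realistic bound for an entry of S - L L^T. The factorised
    matrix is S minus a multiple of the identity: this part of the diagonal is
    left to the residual, and is about twice what diagonal dominance
    requires. *)
Definition find_certificate d m anti : certificate :=
  let pts := half_stratum anti d m in
  let rho := Z.sqrt (2 ^ Z.of_nat (17 - d) * Z.of_nat d ^ Z.of_nat d) in
  (rho, unzip2 (cholesky (scaled d anti) (Z.of_nat (size pts).*2.+2 * rho) pts)).

(** In normal form, so that the check below does not repeat the factorisations. *)
Definition certificates : seq (seq (seq certificate)) := Eval vm_compute in
  [seq [seq [seq find_certificate d m anti | anti <- [:: false; true]]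
       | m <- iota 1 3] | d <- iota 1 17].
Definition certificate_of d m (anti : bool) : certificate :=
  nth (0%BZ, [::]) (nth [::] (nth [::] certificates d.-1) m.-1) anti.

(** The scalar products of rows take some 240 000 products of integers. *)
Lemma certificates_ok :
  all (fun d => all (fun m => all (fun anti =>
    check d m anti (certificate_of d m anti)) [:: false; true]) (iota 1 3))
    (iota 1 17).
Proof. by vm_compute. Qed.

Lemma certificate_okP d m anti : (1 <= d <= 17)%N -> (1 <= m <= 3)%N ->
  check d m anti (certificate_of d m anti).
Proof.
move=> hd hm.
have /allP/(_ d) := certificates_ok; rewrite mem_iota => /(_ ltac:(lia)).
move=> /allP/(_ m); rewrite mem_iota => /(_ ltac:(lia)).
by move=> /allP/(_ anti); apply; case: anti.
Qed.

(** * Positive definiteness on each stratum *)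

Section Posdef.
Variable R : realFieldType.

Lemma half_stratum_qform_ge d m anti :
    (1 <= d <= 17)%N -> (1 <= m <= 3)%N ->
  exists2 c : R, 0 < c & forall f : point -> R,
    c * (\sum_(s <- half_stratum anti d m) f s ^+ 2)
      <= qform (half_stratum anti d m) f (fold_kernel R anti).
Proof.
move=> hd hm; have hd17 : (d <= 17)%N by case/andP: hd.
have := certificate_okP anti hd hm.
case: (certificate_of d m anti) => rho L /and3P[/= rho0 /eqP szL ok].
pose p : R := ofZ R (2 ^ Z.of_nat (17 - d))%BZ.
have p0 : 0 < p by rewrite -(ofZ0 R) ltr_ofZ; lia.
exists (p^-1 * ofZ R rho) => [|f].
  by rewrite mulr_gt0 ?invr_gt0 // -(ofZ0 R) ltr_ofZ.
have rowsE : unzip1 (zip (half_stratum anti d m) L) = half_stratum anti d m.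
  by rewrite unzip1_zip ?szL.
have SE s t : s \in half_stratum anti d m -> t \in half_stratum anti d m ->
    ofZ R (scaled d anti s t) = p * fold_kernel R anti s t.
  by move=> /half_stratum_points hs /half_stratum_points ht; rewrite scaledE.
rewrite -mulrA ler_pdivrMl //.
have := @check_rows_qform_ge R (scaled d anti) rho _ f _ ok.
rewrite rowsE => /(_ _)/le_trans; apply.
  by move=> s t hs ht; apply/eqP; rewrite -(eqr_ofZ R) !SE // fold_kernelC.
rewrite le_eqVlt; apply/orP; left; apply/eqP.
rewrite /qform mulr_sumr; apply: eq_big_seq => s hs.
rewrite mulr_sumr; apply: eq_big_seq => t ht.
by rewrite SE // mulrCA.
Qed.

(** Both folded forms bound a positive multiple of a sum of squares from above,
    so both the even and the odd part of x vanish on the stratum. *)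
Lemma stratum_posdef d m (x : point -> R) :
    (1 <= d <= 17)%N -> (1 <= m <= 3)%N ->
    qform (stratum d m) x (kernel R) <= 0 ->
  {in stratum d m, forall s, x s = 0}.
Proof.
move=> hd hm q0.
have qsym : qform (stratum d m) x (sym_kernel R)
    = 2 * qform (stratum d m) x (kernel R).
  rewrite /sym_kernel qformD mulr2n mulrDl !mul1r; congr (_ + _).
  rewrite /qform exchange_big; apply: eq_bigr => s _; apply: eq_bigr => t _ /=.
  by rewrite (mulrC (x t)).
have symS s t :
    sym_kernel R (swap s) (swap t) = sym_kernel R s t.
  by rewrite /sym_kernel !kernel_swap.
have foldE := qform_fold x (stratum_swap d m) symS.
pose a s := fold_weight R s * (x s + x (swap s)).
pose b s := x s - x (swap s).
have halfE anti : half_stratum anti d m =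
    [seq p <- stratum d m | if anti then p.1.1 < p.1.2 else p.1.1 <= p.1.2]%N.
  by apply: eq_filter => p /=; case: anti; rewrite ?addn0 ?addn1.
have [c c0 lo] := half_stratum_qform_ge false hd hm.
have [c' c'0 lo'] := half_stratum_qform_ge true hd hm.
have {lo lo'} := lerD (lo a) (lo' b).
rewrite !halfE /fold_kernel -foldE qsym mulrA -natrM => le_q.
have sqsum0 (P : seq point) (f : point -> R) : 0 <= \sum_(s <- P) f s ^+ 2.
  by apply: sumr_ge0 => s _; exact: sqr_ge0.
have sq0 (P : seq point) (f : point -> R) : \sum_(s <- P) f s ^+ 2 <= 0 ->
    {in P, forall s, f s = 0}.
  move=> le0 s sP; apply/eqP; rewrite -sqrf_eq0.
  have : \sum_(s <- P) f s ^+ 2 == 0 by rewrite eq_le le0 sqsum0.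
  by rewrite psumr_eq0 => [/allP/(_ s sP)|? _] //; exact: sqr_ge0.
have Sa := mulr_ge0 (ltW c0) (sqsum0 [seq p <- stratum d m | p.1.1 <= p.1.2]%N a).
have Sb := mulr_ge0 (ltW c'0) (sqsum0 [seq p <- stratum d m | p.1.1 < p.1.2]%N b).
have /sq0 a0 : \sum_(s <- [seq p <- stratum d m | p.1.1 <= p.1.2]%N) a s ^+ 2 <= 0.
  by rewrite -(pmulr_rle0 _ c0); lra.
have /sq0 b0 : \sum_(s <- [seq p <- stratum d m | p.1.1 < p.1.2]%N) b s ^+ 2 <= 0.
  by rewrite -(pmulr_rle0 _ c'0); lra.
have both s : s \in stratum d m -> (s.1.1 <= s.1.2)%N ->
    x s = 0 /\ x (swap s) = 0.
  move=> hs le_s; have := a0 s; rewrite mem_filter le_s => /(_ hs).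
  rewrite /a /fold_weight; case: eqVneq => [e|ne].
    have -> : swap s = s by case: (s) e => [[i j] k] /= ->.
    lra.
  have := b0 s; rewrite mem_filter ltn_neqAle ne le_s => /(_ hs).
  by rewrite /b; lra.
move=> s hs; have [le_s|/ltnW ge_s] := leqP s.1.1 s.1.2; first by case: (both s).
have sw : swap s \in stratum d m by rewrite -(perm_mem (stratum_swap d m)) map_f.
by rewrite -(swapK s); case: (both _ sw ge_s).
Qed.

End Posdef.

(** * Unisolvence *)

Definition triple d (t : tri_index d) : point := (idx_i t, idx_j t, idx_k t).

Lemma triple_inj d : injective (@triple d).
Proof.
move=> t t' [ei ej ek]; apply/val_inj; move: ei ej ek.
rewrite /idx_i /idx_j /idx_k.
case: (val t) (val t') => [[i j] k] [[i' j'] k'] /= ei ej ek.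
by congr (_, _, _); apply: val_inj.
Qed.

Lemma perm_points d : perm_eq [seq triple t | t <- enum (tri_index d)] (points d).
Proof.
apply: uniq_perm; rewrite ?points_uniq ?(map_inj_uniq (@triple_inj d)) ?enum_uniq //.
move=> p; rewrite mem_points; apply/mapP/idP => [[t _ ->]|hp].
  exact: (valP t).
have [hi hj hk] : [/\ p.1.1 < d.+1, p.1.2 < d.+1 & p.2 < d.+1]%N by split; lia.
pose t : 'I_d.+1 * 'I_d.+1 * 'I_d.+1 := (Ordinal hi, Ordinal hj, Ordinal hk).
exists (Sub t hp : tri_index d); first by rewrite mem_enum.
by rewrite /triple /idx_i /idx_j /idx_k SubK /=; case: (p) => [[]].
Qed.

Section Unisolvence.
Variable R : realType.

Lemma bernstein_domain_bary d (s t : tri_index d) :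
  bernstein t (domain_bary R s) = kernel R (triple s) (triple t) / d%:R ^+ d.
Proof.
have sumt : (idx_i t + idx_j t + idx_k t)%N = d by apply/eqP; exact: (valP t).
rewrite /bernstein /kernel /= sumt !mxE /= -[RHS]mulrA; congr (_ * _).
have -> : (d%:R : R) ^+ d = d%:R ^+ idx_i t * d%:R ^+ idx_j t * d%:R ^+ idx_k t.
  by rewrite -!exprD sumt.
by rewrite !expr_div_n !invfM; ring.
Qed.

Lemma sum_stratum d m (F : point -> R) :
  \sum_(p <- stratum d m) F p =
  \sum_(t : tri_index d | support_size (triple t) == m) F (triple t).
Proof. by rewrite big_filter -(perm_big _ (perm_points d)) big_map big_enum_cond. Qed.

(** Among the indices where x does not vanish, take one of smallest support size
    m, and let z be the part of x in the stratum m. Row s of the linear system,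
    for s in this stratum, reads the same for z as for x: lower strata carry no
    coefficient, and higher ones have a vanishing kernel at s. Hence the
    quadratic form vanishes at z, and so does z. *)
Lemma bernstein_unisolvent d (hd : (1 <= d <= 17)%N) (Gamma : {set tri_index d})
    (x : tri_index d -> R) :
    (forall s, s \in Gamma ->
      \sum_(t in Gamma) x t * bernstein t (domain_bary R s) = 0) ->
  forall t, t \in Gamma -> x t = 0.
Proof.
move=> x_ker t1 t1G; apply/eqP/negPn/negP => x1.
pose supp t := support_size (@triple d t).
have Pt1 : (t1 \in Gamma) && (x t1 != 0) by rewrite t1G.
case: (@arg_minnP _ t1 (fun t => (t \in Gamma) && (x t != 0)) supp Pt1).
move=> t0 /andP[t0G x0] t0min; set m := supp t0.
pose z t := if (t \in Gamma) && (supp t == m) then x t else 0.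
pose y p := if [pick t | triple t == p] is Some t then z t else 0.
have yE t : y (triple t) = z t.
  by rewrite /y; case: pickP => [t' /eqP/triple_inj->|/(_ t)/eqP].
have dd0 : (d%:R : R) ^+ d != 0 by rewrite expf_neq0 // pnatr_eq0; lia.
have q0 : qform (stratum d m) y (kernel R) = 0.
  rewrite /qform sum_stratum big1 // => s /eqP sm; rewrite sum_stratum yE.
  have [sG|sG] := boolP (s \in Gamma); last first.
    by rewrite big1 // => t _; rewrite {1}/z (negPf sG) !mul0r.
  transitivity (z s * (d%:R ^+ d *
      \sum_(t in Gamma) x t * bernstein t (domain_bary R s))); last first.
    by rewrite x_ker // !mulr0.
  rewrite !mulr_sumr big_mkcond [RHS]big_mkcond /=; apply: eq_bigr => t _.
  rewrite bernstein_domain_bary yE {2}/z.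
  have [tG|] := boolP (t \in Gamma); last by rewrite mulr0 mul0r if_same.
  rewrite -/(supp t); case: ifP => [sm'|/negbT tm] /=.
    by rewrite sm'; field.
  have [->|xt] := eqVneq (x t) 0; first by rewrite mul0r !mulr0.
  have := t0min t; rewrite tG xt => /(_ isT) le_m.
  rewrite (_ : kernel R _ _ = 0) ?mul0r ?mulr0 //; apply/eqP/negPn/negP.
  move=> /kernel_support; rewrite sm; move: le_m tm; rewrite -/m -/(supp t); lia.
have m13 : (1 <= m <= 3)%N.
  have := valP t0; rewrite -/(idx_i t0) -/(idx_j t0) -/(idx_k t0) => /eqP.
  by rewrite /m /supp /support_size /=; lia.
have := @stratum_posdef R d m y hd m13; rewrite q0 => /(_ (lexx _) (triple t0)).
rewrite mem_filter eqxx -(perm_mem (perm_points d)) map_f ?mem_enum //.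
rewrite yE /z t0G eqxx => /(_ isT) /= e.
by rewrite e eqxx in x0.
Qed.

(** The square system restricted to Gamma is completed by the identity outside
    Gamma, which makes injectivity and surjectivity those of one square
    matrix. *)
Lemma bernstein_solvable d (hd : (1 <= d <= 17)%N) (Gamma : {set tri_index d})
    (z : tri_index d -> R) :
  exists c : tri_index d -> R, forall s, s \in Gamma ->
    \sum_(t in Gamma) c t * bernstein t (domain_bary R s) = z s.
Proof.
pose M := \matrix_(i < #|tri_index d|, j < #|tri_index d|)
  let t := enum_val i in let s := enum_val j in
  if s \in Gamma then
    if t \in Gamma then bernstein t (domain_bary R s) else 0
  else (t == s)%:R.
have ME (v : 'rV_#|tri_index d|) s : (v *m M) 0 (enum_rank s) =
    if s \in Gamma
    then \sum_(t in Gamma) v 0 (enum_rank t) * bernstein t (domain_bary R s)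
    else v 0 (enum_rank s).
  rewrite mxE (reindex enum_rank) /=; last first.
    by apply: onW_bij; exact: enum_rank_bij.
  under eq_bigr => t _ do rewrite mxE /= !enum_rankK.
  case: ifP => sG.
    rewrite [RHS]big_mkcond; apply: eq_bigr => t _.
    by case: ifP; rewrite ?mulr0.
  rewrite (bigD1 s) //= eqxx mulr1 big1 ?addr0 // => t /negPf ->.
  by rewrite mulr0.
have Mu : M \in unitmx.
  rewrite -row_free_unit -kermx_eq0; apply/rowV0P => v /sub_kermxP vM0.
  have v0 s : (v *m M) 0 (enum_rank s) = 0 by rewrite vM0 mxE.
  apply/rowP => i; rewrite mxE -(enum_valK i); set s := enum_val i.
  have := v0 s; rewrite ME; case: ifP => // sG _.
  apply: (@bernstein_unisolvent d hd Gamma (fun t => v 0 (enum_rank t))) => //.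
  by move=> s' s'G; have := v0 s'; rewrite ME s'G.
pose w := (\row_j z (enum_val j)) *m invmx M.
exists (fun t => w 0 (enum_rank t)) => s sG.
by have := ME w s; rewrite sG => <-; rewrite mulmxKV // mxE enum_rankK.
Qed.

End Unisolvence.

Theorem theorem3 (R : realType) (T : 'M[R]_(3, 2)) (hT : triangle T)
    (d : nat) (hd : (1 <= d <= 17)%N) (Gamma : {set tri_index d})
    (z : tri_index d -> R) :
  exists! p : 'rV[R]_2 -> R,
    bernstein_form T Gamma p /\
    forall t, t \in Gamma -> p (domain_point T t) = z t.
Proof.
have d0 : (0 < d)%N by case/andP: hd.
have [c cz] := bernstein_solvable hd Gamma z.
exists (fun x => \sum_(t in Gamma) c t * bernstein t (bary T x)).
split; first split; first by exists c.
  by move=> s sG; rewrite bary_domain_point // cz.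
move=> p [[c' pE] pz]; apply/funext => x; rewrite pE; apply: eq_bigr => t tG.
congr (_ * _); apply/eqP; rewrite -subr_eq0; apply/eqP.
apply: (@bernstein_unisolvent R d hd Gamma (fun t => c t - c' t)) => // s sG.
under eq_bigr do rewrite mulrBl.
by rewrite sumrB cz // -(bary_domain_point _ hT d0) -pE pz // subrr.
Qed.
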